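(* Let $S\neq\mathbb{N}$ be a numerical semigroup. The following are equivalent: (i) $c(S)=\bigl(t(S)+1\bigr)n(S)$; (ii) $\sigma(S)=\Theta(S)=0$; (iii) $S$ is symmetric, or $S=T_{m,k}$ for some integers $m\ge3$ and $k\ge1$.
   Context: $\mathbb{N}=\{0,1,2,\dots\}$. A numerical semigroup is a submonoid $S\subseteq\mathbb{N}$ (under addition) with finite complement $G(S)=\mathbb{N}\setminus S$, whose elements are the gaps. Let $S\ne\mathbb{N}$. $g(S)=|G(S)|$, $F=\max G(S)$, $c(S)=F+1$, $n(S)=|S\cap[0,c(S))|$. $S$ is symmetric if $g(S)=c(S)/2$. An integer $f$ is a pseudo-Frobenius number if $f\notin S$ and $f+s\in S$ for all $s\in S\setminus\{0\}$; $\mathrm{PF}(S)$ is the set of these and $t(S)=|\mathrm{PF}(S)|$. For an integer $x\in[1,F]$, $\nu_S(x)=|\{f\in\mathrm{PF}(S): f-x\in S\}|$. Define $$\sigma(S)=\sum_{f\in\mathrm{PF}(S)}|S\cap(f,F]|,\qquad \Theta(S)=\sum_{x\in G(S)}(\nu_S(x)-1).$$ For $m\ge2$ and $k\ge1$, $T_{m,k}=\{0,m,2m,\dots,(k-1)m\}\cup\{x\in\mathbb{N}: x\ge km\}$. *)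

(* Defs.v *)
From mathcomp Require Import all_boot all_order all_algebra finmap.
From mathcomp Require Import all_classical.

Set Implicit Arguments.
Unset Strict Implicit.
Unset Printing Implicit Defensive.

Import Order.TTheory GRing.Theory Num.Theory.
Local Open Scope classical_set_scope.
Local Open Scope ring_scope.

(* Cardinal of a finite set. Since fset_set A is empty when A is infinite, this
   is a junk value 0 on infinite sets; for a numerical semigroup S <> setT it is
   only applied to finite sets below. *)
Definition card (T : choiceType) (A : set T) : nat := #|` fset_set A|%N.

Definition gaps (S : set nat) : set nat := ~` S.

Record numerical_semigroup (S : set nat) : Prop := NumericalSemigroup {
  ns_zero : S 0%N;
  ns_add : forall x y : nat, S x -> S y -> S (x + y)%N;
  ns_cofinite : finite_set (gaps S)
}.

Definition genus (S : set nat) : nat := card (gaps S).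

(* The largest gap; junk value 0 when there are no gaps. *)
Definition frobenius (S : set nat) : nat :=
  \big[maxn/0%N]_(x <- fset_set (gaps S)) x.

Definition conductor (S : set nat) : nat := (frobenius S).+1.

Definition nleft (S : set nat) : nat :=
  card [set s | S s /\ (s < conductor S)%N].

(* g(S) = c(S) / 2, without truncated division. *)
Definition symmetric_semigroup (S : set nat) : Prop :=
  (2 * genus S = conductor S)%N.

(* S as a subset of the integers: pseudo-Frobenius numbers are a priori
   integers, and membership of a difference f - x in S is about the true
   (possibly negative) difference. *)
Definition intset (S : set nat) : set int := Posz @` S.

Definition PF (S : set nat) : set int :=
  [set f | ~ intset S f /\
           forall s : int, intset S s -> s <> 0 -> intset S (f + s)].

Definition sgtype (S : set nat) : nat := card (PF S).

Definition nu (S : set nat) (x : int) : nat :=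
  card [set f | PF S f /\ intset S (f - x)].

Definition sigma (S : set nat) : nat :=
  (\sum_(f <- fset_set (PF S))
     card [set s : int | intset S s /\ (f < s <= (frobenius S)%:Z)%R])%N.

Definition Theta (S : set nat) : int :=
  \sum_(x <- fset_set (gaps S)) ((nu S (x%:Z))%:Z - 1).

Definition Tmk (m k : nat) : set nat :=
  [set x | (exists2 i : nat, (i < k)%N & x = (i * m)%N) \/ (k * m <= x)%N].

(* Main.v *)
Require Import Defs.
From mathcomp Require Import all_boot all_order all_algebra finmap.
From mathcomp Require Import all_classical.
From mathcomp Require Import zify.

(** Every gap [y] lies below a pseudo-Frobenius number [f] with [f - y] in [S],
    so each [nu y - 1] is nonnegative. Counting the pairs [(y, f)] by [f] gives
    [sum_y nu y = t n - sigma], hence [(t + 1) n - c = sigma + Theta] and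
    (i) <-> (ii).

    Assume (ii), let [x] be the largest element of [S] below [F] and
    [e = F - x]. Then [PF = (x, F]], so [t = e], and uniqueness of [f] forces
    distinct elements of [S] below [F] to be at least [e] apart. If [e = 1] then
    [c = 2 n]. If [e >= 2], then [x - 1] is a gap, and it lies below a
    pseudo-Frobenius number only if [e + 1] is in [S]; an element of [S] below
    [F] that is not a multiple of [e + 1] would be at distance at least [e]
    from the multiple below it, hence at distance 1 from the multiple above. *)

Set Implicit Arguments.
Unset Strict Implicit.
Unset Printing Implicit Defensive.

Import Order.TTheory GRing.Theory Num.Theory.

(** * Finite sets as filtered ranges *)

(** Used with [id] for naturals and [Posz] for integers, so that cardinals and sums over [fset_set]
    become sums over ordinals. The bound [N] also gives finiteness, without which [fset_set] would
    be empty. *)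
Lemma perm_fset_set (T : choiceType) (h : nat -> T) (N : nat) (A : set T) :
  injective h -> (forall y, A y -> exists2 x, (x < N)%N & y = h x) ->
  perm_eq (fset_set A) [seq h i | i <- iota 0 N & h i \in A].
Proof.
move=> hinj sub.
have finA : finite_set A.
  apply: (@sub_finite_set _ _ (h @` `I_N)).
    by move=> y /sub [x xN ->]; exists x.
  exact/finite_image/finite_II.
apply: uniq_perm.
- exact: fset_uniq.
- by rewrite map_inj_uniq // filter_uniq // iota_uniq.
move=> y; rewrite in_fset_set //; apply/idP/mapP => [yA|[x]].
  have [x xN yx] := sub _ (set_mem yA).
  by exists x => //; rewrite mem_filter -yx yA mem_iota.
by rewrite mem_filter => /andP[xA _] ->.
Qed.

Lemma card_sum (T : choiceType) (h : nat -> T) (N : nat) (A : set T) :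
  injective h -> (forall y, A y -> exists2 x, (x < N)%N & y = h x) ->
  Defs.card A = (\sum_(i < N) (h i \in A))%N.
Proof.
move=> hinj sub; rewrite /Defs.card (perm_size (perm_fset_set hinj sub)).
rewrite size_map size_filter -sum1_count big_mkcond.
rewrite -(big_mkord xpredT (fun i => nat_of_bool (h i \in A))) /index_iota subn0.
by apply: eq_bigr => i _; case: (_ \in _).
Qed.

Lemma big_fset_set (R : nmodType) (T : choiceType) (h : nat -> T) (N : nat)
    (A : set T) (E : T -> R) :
  injective h -> (forall y, A y -> exists2 x, (x < N)%N & y = h x) ->
  (\sum_(y <- fset_set A) E y = \sum_(i < N | h i \in A) E (h i))%R.
Proof.
move=> hinj sub; rewrite (perm_big _ (perm_fset_set hinj sub)) /= big_map.
rewrite big_filter -(big_mkord (fun i => h i \in A) (fun i => E (h i))).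
by rewrite /index_iota subn0.
Qed.

Lemma intset_Posz (S : set nat) (x : nat) : intset S (Posz x) <-> S x.
Proof. by split=> [[y Sy [<-]]|Sx] //; exists x. Qed.

Lemma intset_sub (S : set nat) (f x : nat) :
  intset S (Posz f - Posz x)%R <-> (x <= f)%N /\ S (f - x)%N.
Proof.
split=> [[y Sy yE]|[xf Sfx]]; last by exists (f - x)%N => //; lia.
by have xf : (x <= f)%N by [lia]; split=> //; have <- : y = (f - x)%N by lia.
Qed.

Lemma bigmax_mem (s : seq nat) (x : nat) :
  x \in s -> (\big[maxn/0]_(y <- s) y)%N \in s.
Proof.
elim: s x => // a [|b s] IH x _; rewrite big_cons; first by rewrite big_nil maxn0 inE.
have sb := IH b (mem_head _ _); rewrite inE.
by case: leqP => _; rewrite ?eqxx // sb orbT.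
Qed.

(** * Frobenius number and multiplicity *)

Section Semigroup.
Variables (S : set nat) (hS : numerical_semigroup S) (hSN : S <> @setT nat).
Local Open Scope nat_scope.
Let F := frobenius S.
Let c := conductor S.

Lemma gap_le_frobenius x : ~ S x -> x <= F.
Proof.
move=> Sx; rewrite /F /frobenius; apply: (@leq_bigmax_seq _ _ xpredT id) => //.
by rewrite in_fset_set ?inE //; exact: ns_cofinite hS.
Qed.

Lemma gt_frobenius x : F < x -> S x.
Proof. by move=> Fx; apply: contrapT => /gap_le_frobenius; lia. Qed.

Lemma frobenius_gap : ~ S F.
Proof.
have [x Sx] : exists x, ~ S x.
  by apply/existsNP => Sall; apply: hSN; apply/seteqP; split.
have fin := ns_cofinite hS.
have : F \in (fset_set (gaps S) : seq nat).
  by apply: (@bigmax_mem _ x); rewrite in_fset_set ?inE.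
by rewrite in_fset_set // inE.
Qed.

Lemma frobenius_gt0 : 0 < F.
Proof. by have := frobenius_gap; case: F => // h; case: h; exact: ns_zero hS. Qed.

Lemma exists_pos : exists s, (0 < s) && (s \in S).
Proof. by exists F.+1; rewrite mem_set //; apply: gt_frobenius. Qed.

(** The multiplicity of [S]. *)
Let m := ex_minn exists_pos.

Lemma mult_spec : [/\ 0 < m, S m & forall s, 0 < s -> S s -> m <= s].
Proof.
rewrite /m; case: ex_minnP => k /andP[k0 /set_mem Sk] kmin; split=> // s s0 Ss.
by apply: kmin; rewrite s0 mem_set.
Qed.

Lemma add_gap x y : S x -> ~ S (x + y) -> ~ S y.
Proof. by move=> Sx Sxy Sy; apply/Sxy/(ns_add hS). Qed.

(** * Pseudo-Frobenius numbers *)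

Lemma PF_Posz (f : nat) :
  PF S (Posz f) <-> ~ S f /\ forall s, 0 < s -> S s -> S (f + s).
Proof.
split=> -[fS fadd]; split.
- by move=> /intset_Posz.
- move=> s s0 Ss; apply/intset_Posz; rewrite PoszD; apply: fadd; last by lia.
  exact/intset_Posz.
- by move=> /intset_Posz.
- move=> _ [s Ss <-] s0; rewrite -PoszD; apply/intset_Posz; apply: fadd => //.
  by case: s s0 {Ss}.
Qed.

Lemma PF_gap (f : nat) : PF S (Posz f) -> ~ S f.
Proof. by case/PF_Posz. Qed.

(** Beyond the bound, this excludes negative elements of [PF S]; for the full semigroup, [-1] would
    be one. *)
Lemma PF_bound (f : int) : PF S f -> exists2 x, x < c & f = Posz x.
Proof.
case: f => [f /PF_gap/gap_le_frobenius fF|k [_ kadd]].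
  by exists f.
have [m0 Sm mmin] := mult_spec.
have S0 := ns_zero hS.
(* a negative pseudo-Frobenius number forces [S] to be stable
   under [s |-> s - m], hence [m = 1] *)
have km : k.+1 = m.
  (* This element [m - (k + 1)] of [S] is smaller than [m], hence zero. *)
  have [x Sx xE] : intset S (Negz k + Posz m)%R.
    by apply: kadd; [exact/intset_Posz|lia].
  have [x0|x0] := posnP x; first by lia.
  by have := mmin _ x0 Sx; lia.
have step x : 0 < x -> S x -> S (x - m).
  move=> x0 Sx; have [y Sy yE] : intset S (Negz k + Posz x)%R.
    by apply: kadd; [exact/intset_Posz|lia].
  by have <- : y = x - m by lia.
have all_mult x : S x -> m %| x.
  elim/ltn_ind: x => x IH Sx; have [->|x0] := posnP x; first exact: dvdn0.
  have mx := mmin _ x0 Sx.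
  by rewrite -(dvdn_subl mx) ?dvdnn // IH //; [lia|exact: step].
(* [F + 1] and [F + 2] are consecutive multiples of [m]. *)
have d1 := all_mult _ (gt_frobenius (ltnSn F)).
have d2 := all_mult _ (gt_frobenius (ltnW (ltnSn F.+1))).
have m1 : m = 1.
  by apply/eqP; rewrite -dvdn1 -(dvdn_addr 1 d1) addn1.
case: frobenius_gap; rewrite -[F]mul1n -m1; elim: F => [|n IH]; first by rewrite muln0.
by rewrite mulnS; apply: (ns_add hS).
Qed.

Lemma Posz_inj : injective Posz.
Proof. by move=> x y []. Qed.

Let inS x : bool := x \in S.
Let P (f : nat) : bool := Posz f \in PF S.

Lemma PF_gapP (f : nat) : reflect (~ S f /\ forall s, 0 < s -> S s -> S (f + s)) (P f).
Proof. by apply: (iffP idP) => [/set_mem/PF_Posz|/PF_Posz ?] //; apply: mem_set. Qed.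

Lemma inSP x : reflect (S x) (inS x).
Proof. exact: (iffP idP) (@set_mem _ _ _) (@mem_set _ _ _). Qed.

(** * The invariants as sums over [[0, c)] *)

Lemma genusE : genus S = \sum_(x < c) ~~ inS x.
Proof.
rewrite /genus (@card_sum _ id c) //.
  by apply: eq_bigr => x _; rewrite /gaps in_setC.
by move=> y /gap_le_frobenius yF; exists y.
Qed.

Lemma genus_sum1 : genus S = \sum_(x < c | ~~ inS x) 1.
Proof. by rewrite genusE [RHS]big_mkcond; apply: eq_bigr => x _; case: inS. Qed.

Lemma nleftE : nleft S = \sum_(x < c) inS x.
Proof.
rewrite /nleft (@card_sum _ id c) //; last by move=> y [_ yc]; exists y.
apply: eq_bigr => x _; congr (nat_of_bool _).
by apply/idP/idP => [/set_mem[Sx _]|/set_mem Sx]; apply: mem_set.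
Qed.

Lemma genus_nleft : genus S + nleft S = c.
Proof.
rewrite genusE nleftE -big_split /= (eq_bigr (fun=> 1)); last by move=> i _; case: inS.
by rewrite sum1_card card_ord.
Qed.

Lemma sgtypeE : sgtype S = \sum_(f < c) P f.
Proof. exact: card_sum Posz_inj PF_bound. Qed.

Lemma nuE (x : nat) : nu S x = \sum_(f < c | P f) ((x <= f) && inS (f - x)).
Proof.
rewrite /nu (card_sum (N := c) Posz_inj); last by move=> y [/PF_bound].
rewrite [RHS]big_mkcond; apply: eq_bigr => f _.
have [Pf|Pf] := boolP (P f).
  congr (nat_of_bool _); apply/idP/andP => [/set_mem[_ /intset_sub[? ?]]|[? /inSP ?]].
    by split=> //; apply/inSP.
  by apply: mem_set; split; [exact: set_mem|apply/intset_sub].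
by apply/eqP; rewrite eqb0; apply: contra Pf => /set_mem[? _]; apply: mem_set.
Qed.

Lemma sigmaE : sigma S = \sum_(f < c | P f) \sum_(s < c) (inS s && (f < s)).
Proof.
rewrite /sigma (big_fset_set (N := c) _ Posz_inj PF_bound); apply: eq_bigr => f _.
rewrite (card_sum (N := c) Posz_inj); last first.
  by move=> _ [[y _ <-] /andP[_ yF]]; exists y.
apply: eq_bigr => s _; congr (nat_of_bool _); apply/idP/andP.
  by move=> /set_mem[/intset_Posz/inSP ? /andP[? _]].
move=> [/inSP Ss fs]; apply: mem_set; split; first exact/intset_Posz.
by apply/andP; split=> //; case: s {Ss fs}.
Qed.

Lemma ThetaE : (Theta S = (\sum_(x < c | ~~ inS x) nu S x)%:Z - (genus S)%:Z)%R.
Proof.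
rewrite /Theta (@big_fset_set _ _ id c) //; last first.
  by move=> y /gap_le_frobenius yF; exists y.
rewrite (eq_bigl (fun x : 'I_c => ~~ inS x)); last by move=> x; rewrite /gaps in_setC.
rewrite sumrB genusE (big_morph Posz PoszD erefl).
congr (_ - _)%R; rewrite (big_morph Posz PoszD erefl) big_mkcond.
by apply: eq_bigr => x _; case: inS.
Qed.

(* the elements [x <= f] of [f - S] are gaps as soon as [f] is one *)
Lemma sum_reflect f : f < c -> ~ S f ->
  \sum_(x < c | ~~ inS x) ((x <= f) && inS (f - x)) =
  \sum_(s < c) (inS s && (s <= f)).
Proof.
move=> fc Sf.
transitivity (\sum_(x < c | x < f.+1) inS (f - x)).
  rewrite big_mkcond [RHS]big_mkcond; apply: eq_bigr => x _ /=; rewrite ltnS.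
  case: (leqP x f) => xf; last by rewrite if_same.
  case: (inSP x) => //= Sx; symmetry; apply/eqP; rewrite eqb0; apply/negP => /inSP Sfx.
  by apply: Sf; rewrite -(subnKC xf); apply: (ns_add hS).
transitivity (\sum_(x < c | x < f.+1) inS x); last first.
  rewrite big_mkcond; apply: eq_bigr => x _; rewrite ltnS.
  by case: ifP => _; rewrite ?andbT ?andbF.
rewrite -(big_ord_widen c (fun x => nat_of_bool (inS (f - x))) fc).
rewrite -(big_ord_widen c (fun x => nat_of_bool (inS x)) fc).
rewrite [RHS](reindex_inj rev_ord_inj) /=.
by apply: eq_bigr => x _; rewrite subSS.
Qed.

(** * Double counting *)

(** For fixed [f], [sum_reflect] counts the elements of [S] up to [f], and [sigma] supplies those
    above, so each [f] contributes [nleft S]. *)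
Lemma sum_nu :
  \sum_(x < c | ~~ inS x) nu S x + sigma S = sgtype S * nleft S.
Proof.
under eq_bigr => x _ do rewrite nuE.
rewrite exchange_big sigmaE -big_split /=.
rewrite sgtypeE big_distrl big_mkcond; apply: eq_bigr => f _ /=.
case: ifP => [/PF_gapP[Sf _]|_]; last by rewrite mul0n.
rewrite sum_reflect // mul1n nleftE -big_split; apply: eq_bigr => s _ /=.
by case: inS => //=; case: leqP.
Qed.

(** * Vanishing of [Theta] and [sigma] *)

(** Take the largest gap [f] in [x + S]: adding a positive element of [S] stays in [x + S], so by
    maximality it leads into [S]. *)
Lemma PF_above x : ~ S x -> exists f, [/\ f < c, P f, x <= f & inS (f - x)].
Proof.
move=> Sx; pose Q f := [&& x <= f, inS (f - x) & ~~ inS f].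
have Qx : exists f, Q f.
  exists x; rewrite /Q leqnn subnn /=; apply/andP; split; last exact/inSP.
  exact/inSP/(ns_zero hS).
have QF f : Q f -> f <= F by case/and3P => _ _ /inSP; exact: gap_le_frobenius.
have [f /and3P[xf fx /inSP Sf] fmax] := ex_maxnP Qx QF.
exists f; split => //; first exact: gap_le_frobenius.
apply/PF_gapP; split=> // s s0 Ss; apply: contrapT => Sfs.
suff : f + s <= f by lia.
apply: fmax; apply/and3P; split; [lia| |exact/inSP].
apply/inSP; rewrite addnC -addnBA //.
by apply: (ns_add hS) => //; exact/inSP.
Qed.

Lemma nu_card (x : nat) : nu S x = #|[pred f : 'I_c | [&& P f, x <= f & inS (f - x)]]|.
Proof.
rewrite nuE -sum1_card big_mkcond [RHS]big_mkcond; apply: eq_bigr => f _ /=.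
by rewrite inE /=; case: (P f) => //=; case: (_ && _).
Qed.

Lemma nu_gt0 (x : nat) : ~ S x -> 0 < nu S x.
Proof.
move=> /PF_above[f [fc Pf xf Sfx]]; rewrite nu_card.
by apply/card_gt0P; exists (Ordinal fc); rewrite inE /= Pf xf.
Qed.

Lemma nu_le1P (x : nat) : nu S x <= 1 <->
  forall f g, P f -> P g -> x <= f -> x <= g ->
    S (f - x) -> S (g - x) -> f = g.
Proof.
rewrite nu_card; split=> [/card_le1_eqP eq1 f g Pf Pg xf xg /inSP Sf /inSP Sg|eq1].
  have lt_c h : P h -> h < c by case/PF_gapP => Sh _; exact: gap_le_frobenius.
  have := eq1 (Ordinal (lt_c _ Pf)) (Ordinal (lt_c _ Pg)).
  by rewrite !inE /= Pf Pg xf xg Sf Sg => /(_ isT isT)[].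
apply/card_le1_eqP => f g; rewrite !inE => /and3P[Pf xf /inSP Sf] /and3P[Pg xg /inSP Sg].
by apply: val_inj; apply: (eq1 g f).
Qed.

(** [Theta] is the difference of the two sides, so the equality case describes its vanishing. *)
Lemma genus_sum_nu : genus S <= \sum_(x < c | ~~ inS x) nu S x
  ?= iff [forall (x : 'I_c | ~~ inS x), nu S x == 1].
Proof.
rewrite genus_sum1.
apply: leqif_sum => x /inSP Sx; split; [exact: nu_gt0|exact: eq_sym].
Qed.

Lemma Theta_eq0P : Theta S = 0%R <-> forall x : nat, ~ S x -> nu S x <= 1.
Proof.
have [_ eq_iff] := genus_sum_nu; rewrite ThetaE; split=> [T0 x Sx|nu1].
  have /forallP : [forall (x : 'I_c | ~~ inS x), nu S x == 1] by rewrite -eq_iff; lia.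
  have xc : x < c by exact: gap_le_frobenius.
  by move/(_ (Ordinal xc))/implyP => /(_ (introN (inSP x) Sx))/eqP /= ->.
suff : [forall (x : 'I_c | ~~ inS x), nu S x == 1] by rewrite -eq_iff; lia.
apply/forallP => x; apply/implyP => /inSP Sx.
by rewrite eqn_leq nu1 // nu_gt0.
Qed.

Lemma sigma_eq0P : sigma S = 0 <-> forall f s, P f -> S s -> s <= F -> s <= f.
Proof.
rewrite sigmaE; split=> [/eqP|le_f].
  rewrite sum_nat_eq0 => /forallP s0 f s Pf Ss sF.
  have fc : f < c by case/PF_gapP: Pf => Sf _; exact: gap_le_frobenius.
  move: (s0 (Ordinal fc)); rewrite /= Pf /= sum_nat_eq0.
  move=> /forallP/(_ (Ordinal (sF : s < c))).
  by rewrite /= eqb0 (introT (inSP s) Ss) /= -leqNgt.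
apply: big1 => f Pf; apply: big1 => s _; apply/eqP; rewrite eqb0.
by apply/negP => /andP[/inSP Ss]; rewrite ltnNge (le_f f s) // -ltnS.
Qed.

(** * Equivalence of (i) and (ii) *)

Lemma conductor_iff :
  conductor S = (sgtype S + 1) * nleft S <-> sigma S = 0 /\ Theta S = 0%R.
Proof.
have [le_g _] := genus_sum_nu.
have sn := sum_nu; have gn := genus_nleft; rewrite ThetaE.
rewrite mulnDl mul1n -sn -[conductor S]gn.
(* After cancelling [nleft S], the equality reads [g = N + sigma], where [g <= N]. *)
move: (\sum_(x < c | _) _) le_g => N le_g.
by split=> [|[]]; lia.
Qed.

(** * Symmetric semigroups and [Tmk] *)

(** The map [s |-> F - s] sends elements of [S] below [c] to gaps; by symmetry it reaches all of
    them. A pseudo-Frobenius [f < F] would then give [F = f + (F - f)] in [S], so the type is 1. *)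
Lemma symmetric_conductor :
  symmetric_semigroup S -> conductor S = (sgtype S + 1) * nleft S.
Proof.
move=> sym; have gn := genus_nleft.
have refl := sum_reflect (ltnSn F) frobenius_gap.
have nE : \sum_(s < c) (inS s && (s <= F)) = nleft S.
  by rewrite nleftE; apply: eq_bigr => s _; rewrite -ltnS ltn_ord andbT.
have [_] : \sum_(x < c | ~~ inS x) ((x <= F) && inS (F - x))
    <= \sum_(x < c | ~~ inS x) 1
    ?= iff [forall (x : 'I_c | ~~ inS x), (x <= F) && inS (F - x)].
  by apply: leqif_sum => x _; case: (_ && _).
rewrite refl nE -genus_sum1.
have -> : nleft S == genus S
  by move: sym; rewrite /symmetric_semigroup -/c; lia.
move=> /esym/forallP sgap.
suff -> : sgtype S = 1 by move: sym; rewrite /symmetric_semigroup -/c; lia.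
rewrite sgtypeE /c /conductor big_ord_recr /= big1 => [|f _].
  rewrite (introT (PF_gapP _)) //; split; first exact: frobenius_gap.
  by move=> s s0 _; apply: gt_frobenius; lia.
apply/eqP; rewrite eqb0; apply/negP => /PF_gapP[Sf fadd].
have := sgap (widen_ord (leqnSn F) f); rewrite /= (introN (inSP _) Sf) /=.
move=> /andP[_ /inSP SFf].
have := fadd (F - f) _ SFf; rewrite subn_gt0 ltn_ord subnKC 1?ltnW // => /(_ isT).
exact: frobenius_gap.
Qed.

Lemma ns_mul i x : S x -> S (i * x).
Proof.
move=> Sx; elim: i => [|i IH]; first exact: ns_zero hS.
by rewrite mulSn; apply: (ns_add hS).
Qed.

(** Pseudo-Frobenius numbers lie strictly between [(k - 1) M] and [k M], above all elements of [S]
    up to [F]. Two of them serving the same [x] are congruent modulo [M], hence equal. *)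
Lemma Tmk_sigma_Theta (M k : nat) : 1 < M -> 0 < k -> S = Tmk M k ->
  sigma S = 0 /\ Theta S = 0%R.
Proof.
move=> M1 k0 ST.
have Sge x : k * M <= x -> S x by move=> kx; rewrite ST; right.
have Smul x : M %| x -> S x.
  case/dvdnP => i ->; have [ik|ik] := ltnP i k; first by rewrite ST; left; exists i.
  by apply: Sge; rewrite leq_mul2r ik orbT.
have Slt x : S x -> x < k * M -> M %| x.
  by rewrite ST => -[[i _ ->] _|]; [exact: dvdn_mull|rewrite leqNgt => /negP].
have lt_gap x : ~ S x -> x < k * M by move=> Sx; rewrite ltnNge; apply/negP => /Sge.
have PFwin f : P f -> k.-1 * M < f < k * M.
  case/PF_gapP=> Sf fadd; rewrite lt_gap // andbT ltnNge; apply/negP => fk.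
  move: fk; rewrite leq_eqVlt => /predU1P[fE|fk].
    by apply: Sf; rewrite fE; apply/Smul/dvdn_mull.
  (* Here [f + M] is still below [k M], so it is a multiple of [M], and so is [f]. *)
  apply/Sf/Smul; rewrite -(dvdn_addl f (dvdnn M)); apply: Slt.
    by apply: fadd; [lia|exact: Smul].
  by rewrite -(prednK k0) mulSn; lia.
split.
  apply/sigma_eq0P => f s /PFwin/andP[kf _] Ss sF.
  have sk : s < k * M := leq_ltn_trans sF (lt_gap _ frobenius_gap).
  have /dvdnP[i sE] := Slt _ Ss sk; apply: leq_trans (ltnW kf).
  by move: sk; rewrite sE ltn_mul2r leq_mul2r => /andP[_ ik]; apply/orP; right; lia.
apply/Theta_eq0P => x Sx; apply/nu_le1P.
have main f g : P f -> P g -> x <= f -> x <= g -> S (f - x) -> S (g - x) -> f <= g.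
  move=> /PFwin Hf /PFwin Hg xf xg Sf Sg; rewrite leqNgt; apply/negP => gf.
  have df : M %| f - x by apply: Slt => //; lia.
  have dg : M %| g - x by apply: Slt => //; lia.
  have : M %| f - g by have -> : f - g = f - x - (g - x) by [lia]; exact: dvdn_sub.
  move/dvdn_leq; rewrite subn_gt0 => /(_ gf).
  by move: Hf Hg; rewrite -{2 4}(prednK k0) !mulSn; lia.
by move=> f g *; apply/eqP; rewrite eqn_leq; apply/andP; split; apply: main.
Qed.

(** * Structure when [sigma] and [Theta] vanish *)

Lemma sigma_Theta_structure : sigma S = 0 -> Theta S = 0%R ->
  symmetric_semigroup S \/
  exists m k : nat, 3 <= m /\ 1 <= k /\ S = Tmk m k.
Proof.
move=> sg0 Th0.
have ci : conductor S = (sgtype S + 1) * nleft S by apply/conductor_iff.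
move/sigma_eq0P: sg0 => PF_ge.
have PF_uniq x Sx := (nu_le1P x).1 (Theta_eq0P.1 Th0 x Sx).
have [m0 Sm mmin] := mult_spec.
have exQ : exists s, inS s && (s <= F).
  by exists 0; rewrite leq0n andbT; apply/inSP/(ns_zero hS).
have [x /andP[/inSP Sx xF] xmax] := ex_maxnP exQ (fun s => @proj2 _ _ \o andP).
have {}xmax s : S s -> s <= F -> s <= x.
  by move=> Ss sF; apply: xmax; rewrite sF andbT; apply/inSP.
have {}xF : x < F.
  rewrite ltn_neqAle xF andbT; apply/eqP => xF'.
  by apply: frobenius_gap; rewrite -/F -xF'.
(* Hence adding a positive element of [S] to any integer above [x] passes [F]. *)
have Fxm : F < x + m.
  by rewrite ltnNge; apply/negP => /(xmax _ (ns_add hS Sx Sm)); lia.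
have PE f : P f <-> x < f <= F.
  split=> [Pf|/andP[xf fF]].
    have /PF_gapP[Sf _] := Pf; rewrite gap_le_frobenius // andbT ltn_neqAle.
    rewrite PF_ge //; last exact: ltnW.
    by rewrite andbT; apply/eqP => xf; apply: Sf; rewrite -xf.
  apply/PF_gapP; split=> [Sf|s s0 Ss]; first by have := xmax _ Sf fF; lia.
  by apply: gt_frobenius; have := mmin _ s0 Ss; lia.
pose e := F - x.
have [e1|e2] : e = 1 \/ 1 < e by rewrite /e; lia.
  left; suff t1 : sgtype S = 1.
    by have := genus_nleft; rewrite /symmetric_semigroup /c ci t1; lia.
  rewrite sgtypeE /c /conductor big_ord_recr /= big1 => [|f _].
    by rewrite (_ : P _) //; apply/PE; rewrite -/F; lia.
  by apply/eqP; rewrite eqb0; apply/negP => /PE; have := ltn_ord f; rewrite -/F; lia.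
(* otherwise [F - s'] would be a difference [f - s] for two values of [f] *)
have spaced s s' : S s -> S s' -> s < s' -> s' <= F -> s + e <= s'.
  move=> Ss Ss' ss' sF; rewrite leqNgt; apply/negP => close.
  have gap : ~ S (F - s').
    by apply: (add_gap Ss'); rewrite subnKC //; exact: frobenius_gap.
  have : F = F - (s' - s).
    apply: (PF_uniq (F - s')) => //.
    - by apply/PE; rewrite xF leqnn.
    - by apply/PE; move: close; rewrite /e; lia.
    - by lia.
    - by lia.
    - by have -> : F - (F - s') = s' by lia.
    - by have -> : F - (s' - s) - (F - s') = s by lia.
  by lia.
pose M := e.+1.
have SM : S M.
  (* If [M <= F], then [x > 0] because [F = x + e], so [x.-1] is a true predecessor. *)
  have [MF|/gt_frobenius//] := leqP M F.
  have Sx1 : ~ S x.-1.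
    move=> Sx1; have := spaced _ _ Sx1 Sx; rewrite /M /e in MF *; lia.
  have [f [_ /PE fF fx /inSP Sfx]] := PF_above Sx1.
  (* The difference is at most [F - x + 1 = M], while [F < x + m] gives [M <= m]. *)
  have : m <= f - x.-1 by apply: mmin => //; move: MF; rewrite /M /e; lia.
  by move=> mf; have <- : f - x.-1 = M by move: MF; rewrite /M /e; lia.
have Mdvd y : S y -> y <= F -> M %| y.
  move=> Sy yF; rewrite /dvdn; apply: contrapT => /negP r0.
  have rM : y %% M < M by rewrite ltn_mod.
  move: (divn_eq y M) rM r0; move: (y %/ M) (y %% M) => q r yE rM r0.
  have Sq := ns_mul q SM.
  (* Spacing forces [r = e], so [y + 1] is the next multiple of [M], too close to [y]. *)
  have sp : q * M + e <= y by apply: spaced => //; lia.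
  have Sy1 : S y.+1.
    have -> : y.+1 = q.+1 * M by rewrite mulSn /M; move: rM sp; rewrite /M; lia.
    exact: ns_mul.
  have := spaced _ _ Sy Sy1 (ltnSn y).
  have : y != F by apply/eqP => yF'; apply: frobenius_gap; rewrite -/F -yF'.
  by lia.
have [q xE] := dvdnP (Mdvd _ Sx (ltnW xF)).
(* The conductor is thus a multiple of [M], which dictates [k = q + 1]. *)
have FE : F.+1 = q.+1 * M by rewrite mulSn -xE /M /e; lia.
right; exists M, q.+1; split; first by rewrite /M; lia.
split=> //; apply/seteqP; split=> [y Sy|y [[i _ ->]|yF]].
- have [yF|yF] := leqP y F; last by right; rewrite -FE.
  left; have [i yE] := dvdnP (Mdvd _ Sy yF); exists i => //.
  by move: yF; rewrite -ltnS FE yE ltn_mul2r => /andP[].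
- exact: ns_mul.
- by apply: gt_frobenius; rewrite FE.
Qed.
End Semigroup.

Theorem theorem6p3 (S : set nat) (hS : numerical_semigroup S)
    (hSN : S <> @setT nat) :
  [<-> conductor S = ((sgtype S + 1) * nleft S)%N;
       sigma S = 0%N /\ Theta S = 0%R;
       symmetric_semigroup S \/
         exists m k : nat, (3 <= m)%N /\ (1 <= k)%N /\ S = Tmk m k].
Proof.
tfae.
- exact: (conductor_iff hS hSN).1.
- by case; exact: sigma_Theta_structure.
- case=> [|[m [k [m3 [k1 ST]]]]]; first exact: symmetric_conductor.
  by apply/conductor_iff => //; apply: Tmk_sigma_Theta ST => //; exact: ltnW.
Qed.
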